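(* Let $\xi(x,y)=\max(x,y,0)$, let $T$ be even, and assume the feature matrix $\mathbf{F}\in\mathbb{R}^{M\times M}$ of the templates $\mathbb{X}$ is invertible. For every positive integer $R$ there exists a generalized RNN with $\xi$-nonlinearity and all ranks $R_1,\dots,R_{T-1}\le R$ such that every generalized shallow network with $\xi$-nonlinearity whose grid tensor (with respect to the same feature map and templates) equals the grid tensor of this RNN has width at least $\frac{2}{MT}\min(M,R)^{T/2}$.
   Context: Fix positive integers $N,M$ and $T$, a feature map $f_\theta:\mathbb{R}^N\to\mathbb{R}^M$, and template vectors $\mathbb{X}=\{\mathbf{x}^{(1)},\dots,\mathbf{x}^{(M)}\}\subset\mathbb{R}^N$. An input is a sequence $X=(\mathbf{y}^{(1)},\dots,\mathbf{y}^{(T)})$ with $\mathbf{y}^{(t)}\in\mathbb{R}^N$. The feature matrix $\mathbf{F}\in\mathbb{R}^{M\times M}$ is the matrix whose $i$-th row is $f_\theta(\mathbf{x}^{(i)})^\top$. The operator $\xi(x,y)=\max(x,y,0)$ is extended to any number of operands by $\xi(x_1,\dots,x_n)=\max(x_1,\dots,x_n,0)$. A generalized shallow network of width (rank) $R'$ with $\xi$-nonlinearity has parameters $\lambda_r\in\mathbb{R}$, $\mathbf{v}_r^{(t)}\in\mathbb{R}^M$ ($1\le r\le R'$, $1\le t\le T$) and score function $\ell(X)=\sum_{r=1}^{R'}\lambda_r\,\xi\big(\langle f_\theta(\mathbf{y}^{(1)}),\mathbf{v}_r^{(1)}\rangle,\dots,\langle f_\theta(\mathbf{y}^{(T)}),\mathbf{v}_r^{(T)}\rangle\big)$.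 A generalized RNN with $\xi$-nonlinearity, with ranks $R_1,\dots,R_{T-1}$ (and $R_0=R_T=1$), has parameters $\mathbf{C}^{(t)}$ and $\mathcal{G}^{(t)}$, $t=1,\dots,T$, where $\mathbf{C}^{(t)}\in\mathbb{R}^{L\times M}$ and $\mathcal{G}^{(t)}\in\mathbb{R}^{L\times R_{t-1}\times R_t}$ for some positive integer $L$. Its hidden states $\mathbf{h}^{(t)}\in\mathbb{R}^{R_t}$ are $\mathbf{h}^{(t)}_k=\sum_{i,j}\mathcal{G}^{(t)}_{ijk}\,\xi\big([\mathbf{C}^{(t)}f_\theta(\mathbf{y}^{(t)})]_i,\mathbf{h}^{(t-1)}_j\big)$, with initial state $\mathbf{h}^{(0)}=0\in\mathbb{R}^1$ (the unit of $\xi$). Its score function is $\ell(X)=\mathbf{h}^{(T)}\in\mathbb{R}^1$. The grid tensor of a score function $\ell$ is the order-$T$ tensor $\boldsymbol{\Gamma}^{\ell}(\mathbb{X})\in\mathbb{R}^{M\times\cdots\times M}$ with entries $\boldsymbol{\Gamma}^{\ell}(\mathbb{X})_{i_1\dots i_T}=\ell\big((\mathbf{x}^{(i_1)},\dots,\mathbf{x}^{(i_T)})\big)$, $i_1,\dots,i_T\in\{1,\dots,M\}$. *)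

(* Defs.v *)
From mathcomp Require Import all_boot all_order all_algebra.
From mathcomp Require Import reals.

Set Implicit Arguments.
Unset Strict Implicit.
Unset Printing Implicit Defensive.

Import Order.TTheory GRing.Theory Num.Theory.
Local Open Scope ring_scope.

Definition xi (R : realType) (x y : R) : R := Num.max (Num.max x y) 0.

(* The starting value 0 of the iterated maximum is the trailing operand of
   xi(x_1, ..., x_n) = max(x_1, ..., x_n, 0). *)
Definition xin (R : realType) (n : nat) (x : 'I_n -> R) : R :=
  \big[Num.max/0]_(i < n) x i.

Definition dotv (R : realType) (M : nat) (u v : 'cV[R]_M) : R :=
  \sum_(m < M) u m 0 * v m 0.

Definition input (R : realType) (N T : nat) : Type := 'I_T -> 'cV[R]_N.

Definition feature_matrix (R : realType) (N M : nat)
    (f : 'cV[R]_N -> 'cV[R]_M) (x : 'I_M -> 'cV[R]_N) : 'M[R]_M :=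
  \matrix_(i < M, j < M) f (x i) j 0.

Record shallow_net (R : realType) (M T : nat) := ShallowNet {
  sn_width : nat;
  sn_lambda : 'I_sn_width -> R;
  sn_v : 'I_sn_width -> 'I_T -> 'cV[R]_M
}.

Definition shallow_score (R : realType) (N M T : nat)
    (f : 'cV[R]_N -> 'cV[R]_M) (S : shallow_net R M T) (X : input R N T) : R :=
  \sum_(r < sn_width S)
    sn_lambda r * xin (fun t : 'I_T => dotv (f (X t)) (sn_v r t)).

(* [rnn_rank t] is R_t for 0 <= t <= T; its values beyond T play no role.
   Parameters and inputs are indexed from 0: for t : 'I_T, [rnn_C t] and
   [rnn_G t] are C^(t+1) and G^(t+1), which take h^(t) to h^(t+1). *)
Record rnn (R : realType) (M T : nat) := Rnn {
  rnn_rank : nat -> nat;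
  rnn_rank_gt0 : forall t : nat, (t <= T)%N -> (0 < rnn_rank t)%N;
  rnn_rank0 : rnn_rank 0 = 1%N;
  rnn_rankT : rnn_rank T = 1%N;
  rnn_L : nat;
  rnn_L_gt0 : (0 < rnn_L)%N;
  rnn_C : 'I_T -> 'M[R]_(rnn_L, M);
  rnn_G : forall t : 'I_T,
    'I_rnn_L -> 'I_(rnn_rank t) -> 'I_(rnn_rank t.+1) -> R
}.

Fixpoint rnn_hidden (R : realType) (N M T : nat)
    (f : 'cV[R]_N -> 'cV[R]_M) (W : rnn R M T) (X : input R N T) (t : nat) :
    (t <= T)%N -> 'I_(rnn_rank W t) -> R :=
  match t return (t <= T)%N -> 'I_(rnn_rank W t) -> R with
  | 0%N => fun _ _ => 0
  | s.+1 => fun (lt_sT : (s < T)%N) k =>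
      let o := Ordinal lt_sT in
      \sum_(i < rnn_L W) \sum_(j < rnn_rank W s)
        rnn_G (r := W) (t := o) i j k
          * xi ((rnn_C W o *m f (X o)) i 0)
               (rnn_hidden f X (ltnW lt_sT) j)
  end.

Definition rnn_score (R : realType) (N M T : nat)
    (f : 'cV[R]_N -> 'cV[R]_M) (W : rnn R M T) (X : input R N T) : R :=
  rnn_hidden f X (leqnn T) (cast_ord (esym (rnn_rankT W)) ord0).

Definition grid_tensor (R : realType) (N M T : nat)
    (x : 'I_M -> 'cV[R]_N) (l : input R N T -> R) :
    {ffun T.-tuple 'I_M -> R} :=
  [ffun i : T.-tuple 'I_M => l (fun t : 'I_T => x (tnth i t))].

(* Main.v *)
(* The network is built so that its grid tensor, on template indices below
   r = min(M, rmax), equals 1 if i_1 = i_2, i_3 = i_4, ..., i_(T-1) = i_T and 0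
   otherwise.  Matricized along odd versus even positions this is an identity
   matrix of size r^(T/2).  A single xi-term of a shallow network matricizes to
   max(u_a, w_b), where u_a is one of at most r T/2 numbers, hence has
   rank at most M T/2; subadditivity of the rank gives the bound. *)
Require Import Defs.
From mathcomp Require Import all_boot all_order all_algebra.
From mathcomp Require Import reals.

Set Implicit Arguments.
Unset Strict Implicit.
Unset Printing Implicit Defensive.

Import Order.TTheory GRing.Theory Num.Theory.
Local Open Scope ring_scope.

(** * Disjunction through [xi], and rank bounds *)

Lemma xi_bool (R : realType) (a b : bool) : xi a%:R b%:R = (a || b)%:R :> R.
Proof.
by case: a b => -[]; rewrite /xi /= ?maxxx // ?(max_l ler01) ?(max_r ler01)
   ?(max_l ler01).
Qed.

Lemma mxrank_sum_leq (F : fieldType) (m n k d : nat)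
    (B : 'I_k -> 'M[F]_(m, n)) :
  (forall i, \rank (B i) <= d)%N -> (\rank (\sum_i B i)%R <= k * d)%N.
Proof.
move=> leBd; have -> : (k * d = \sum_(i < k) d)%N.
  by rewrite sum_nat_const card_ord.
elim/big_ind2: _ => [|A a B' b leA leB|i _]; first by rewrite mxrank0.
  exact: leq_trans (mxrank_add _ _) (leq_add leA leB).
exact: leBd.
Qed.

(** Row [i] depends only on [q i], so the matrix is a 0/1 selection matrix times the table of the at
    most [#|Q|] distinct rows. *)
Lemma mxrank_factor_leq (F : fieldType) (m n : nat) (Q : finType)
    (q : 'I_m -> Q) (D : Q -> 'I_n -> F) :
  (\rank (\matrix_(i, j) D (q i) j)%R <= #|Q|)%N.
Proof.
pose P : 'M[F]_(m, #|Q|) := \matrix_(i, k) (enum_rank (q i) == k)%:R.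
pose E : 'M[F]_(#|Q|, n) := \matrix_(k, j) D (enum_val k) j.
suff -> : (\matrix_(i, j) D (q i) j)%R = P *m E by exact: mulmx_max_rank.
apply/matrixP=> i j; rewrite !mxE (bigD1 (enum_rank (q i))) //= big1.
  by rewrite !mxE eqxx mul1r addr0 enum_rankK.
by move=> k /negPf nk; rewrite !mxE eq_sym nk mul0r.
Qed.

(** * A recurrent network testing equality within consecutive pairs *)

Section PairingNetwork.
Variables (R : realType) (M T r : nat).
Hypotheses (T_gt0 : (0 < T)%N) (r_gt0 : (0 < r)%N) (T_even : ~~ odd T).

Definition pairing_rank (t : nat) : nat := if odd t then r else 1.

(* The additional row r acts as a bias. *)
Definition mismatch_mx : 'M[R]_(r.+1, M) :=
  \matrix_(i, m) ((i == r :> nat) || (i != m :> nat))%:R.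

(* The state at even times t < T is 1 if some pair so far is mismatched and 0
   otherwise; the last step outputs the complement. *)
Definition pairing_weight (t i j k : nat) : R :=
  if odd t then
    if t.+1 == T then r%:R * ((i == r) && (j == 0%N))%:R - (i == j)%:R
    else (i == j)%:R - r.-1%:R * ((i == r) && (j == 0%N))%:R
  else (i == k)%:R.

Lemma pairing_rank_gt0 (t : nat) : (t <= T)%N -> (0 < pairing_rank t)%N.
Proof. by rewrite /pairing_rank; case: ifP. Qed.

Lemma pairing_rankT : pairing_rank T = 1%N.
Proof. by rewrite /pairing_rank (negPf T_even). Qed.

Definition pairing_rnn (F : 'M[R]_M) : rnn R M T :=
  @Rnn R M T pairing_rank pairing_rank_gt0 erefl pairing_rankT r.+1 isT
    (fun=> mismatch_mx *m (invmx F)^T)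
    (fun t i j k => pairing_weight t i j k).

Definition mismatched (y : nat -> nat) (n : nat) : bool :=
  has (fun k => y k.*2 != y k.*2.+1) (iota 0 n).

Lemma mismatchedS (y : nat -> nat) (n : nat) :
  mismatched y n.+1 = mismatched y n || (y n.*2 != y n.*2.+1).
Proof. by rewrite /mismatched -addn1 iotaD has_cat /= orbF. Qed.

(** The [j]-th term vanishes only for [j = a = b] with [e] false, so the sum falls short of [r] by
    one exactly when the current pair agrees and the flag [e] of earlier mismatches is off. *)
Lemma sum_mismatch (e : bool) (a b : nat) : (a < r)%N ->
  \sum_(j < r) ((j != a :> nat) || (e || (b != j)))%:R
    = r%:R - (~~ (e || (b != a)))%:R :> R.
Proof.
move=> lt_ar; transitivity
    (\sum_(j < r) (1 - ((j == Ordinal lt_ar) && ~~ (e || (b != a)))%:R) : R).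
  apply: eq_bigr => j _; rewrite -val_eqE /=.
  by case: eqP => [->|_] /=; rewrite ?subr0 //;
    case: (_ || _); rewrite ?subr0 ?subrr.
rewrite sumrB sumr_const card_ord; congr (_ - _).
rewrite (bigD1 (Ordinal lt_ar)) //= eqxx big1 ?addr0 //.
by move=> j /negPf ->.
Qed.

Section Grid.
Variables (N : nat) (f : 'cV[R]_N -> 'cV[R]_M) (x : 'I_M -> 'cV[R]_N).
Hypothesis F_inv : feature_matrix f x \in unitmx.
Variable y : nat -> 'I_M.
Hypothesis y_lt : forall t, (y t < r)%N.

Let W := pairing_rnn (feature_matrix f x).

(** [f (x m)] is column [m] of the transposed feature matrix, so the factor [(invmx F)^T] cancels it
    and leaves column [m] of [mismatch_mx]. *)
Lemma mismatch_mxE (i : 'I_r.+1) (m : 'I_M) :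
  (mismatch_mx *m (invmx (feature_matrix f x))^T *m f (x m)) i 0
    = ((i == r :> nat) || (i != m :> nat))%:R.
Proof.
have -> : f (x m) = (feature_matrix f x)^T *m delta_mx m 0.
  by rewrite -colE; apply/colP => k; rewrite !mxE.
by rewrite -mulmxA (mulmxA _^T) -trmx_mul mulmxV // trmx1 mul1mx -colE !mxE.
Qed.

(** An even step [s] stores [y s] as a mismatch vector of length [r], disjoined with the flag. An
    odd step sums the disjunction of the stored and the new vector over the diagonal, which gives
    [r] or [r - 1]; the bias constant turns this into the new flag, or into its complement at the
    last step. *)
Lemma pairing_stepE (s j : nat) : (s < T)%N -> (j < pairing_rank s.+1)%N ->
  \sum_(i < r.+1) \sum_(k < pairing_rank s) pairing_weight s i k j *
    (((i == r :> nat) || (i != y s :> nat))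
      || (mismatched y s./2 || odd s && (y s.-1 != k :> nat)))%:R
  = if s.+1 == T then (~~ mismatched y s.+1./2)%:R
    else (mismatched y s.+1./2 || odd s.+1 && (y s != j :> nat))%:R.
Proof.
rewrite /pairing_weight /pairing_rank /= => lt_sT.
case odd_s: (odd s) => /= lt_jr; last first.
  have /negPf -> : s.+1 != T.
    by apply: contraNneq T_even => <-; rewrite /= odd_s.
  rewrite uphalf_half odd_s add0n.
  rewrite (bigD1 (Ordinal (ltnW lt_jr : j < r.+1)%N)) //=.
  rewrite [X in _ + X]big1 ?addr0.
    rewrite big_ord1 eqxx mul1r (ltn_eqF lt_jr) /= orbF orbC.
    by rewrite [j == _]eq_sym.
  move=> i; rewrite -val_eqE /= => /negPf nij.
  by rewrite big_ord1 nij mul0r.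
have half_s : (uphalf s = s./2.+1)%N by rewrite uphalf_half odd_s.
have dbl_s : (s./2.*2 = s.-1)%N.
  by rewrite -[in RHS](odd_double_half s) odd_s.
have dblS_s : (s./2.*2.+1 = s)%N by rewrite dbl_s prednK // odd_gt0.
rewrite half_s mismatchedS dblS_s dbl_s; set e := mismatched y _.
set E := e || _.
(* Odd steps weight the diagonal by [c] and the bias entry by [b]: [(c, b)] is [(-1, r)] at the last
   step and [(1, -(r-1))] at the others. *)
have sumE (c b : R) :
    \sum_(i < r.+1) \sum_(k < r)
      (c * (i == k :> nat)%:R + b * ((i == r :> nat) && (k == 0%N :> nat))%:R) *
      (((i == r :> nat) || (i != y s :> nat)) || (e || (y s.-1 != k :> nat)))%:R
    = c * (r%:R - (~~ E)%:R) + b.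
  (* The last row [i = r] is the bias: the disjunction holds there, so it contributes exactly
     [b]. *)
  rewrite big_ord_recr /= eqxx; congr (_ + _).
    rewrite -sum_mismatch // mulr_sumr; apply: eq_bigr => i _.
    rewrite (bigD1 i) //= [X in _ + X]big1 ?addr0 => [|k].
      by rewrite eqxx (ltn_eqF (ltn_ord i)) mulr0 addr0 mulr1.
    rewrite -val_eqE /= eq_sym => /negPf ->.
    by rewrite (ltn_eqF (ltn_ord i)) !mulr0 addr0 mul0r.
  rewrite (bigD1 (Ordinal r_gt0)) //= [X in _ + X]big1 ?addr0 => [|k].
    by rewrite eqn0Ngt r_gt0 mulr0 add0r !mulr1.
  rewrite -val_eqE /= => /negPf ->.
  by rewrite gtn_eqF // !mulr0 addr0 mul0r.
case: ifP => _.
  transitivity (-1 * (r%:R - (~~ E)%:R) + r%:R : R).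
    rewrite -sumE; apply: eq_bigr => i _; apply: eq_bigr => k _.
    by rewrite mulN1r [- _ + _]addrC.
  by rewrite mulN1r opprB subrK.
transitivity (1 * (r%:R - (~~ E)%:R) - r.-1%:R : R).
  rewrite -sumE; apply: eq_bigr => i _; apply: eq_bigr => k _.
  by rewrite mul1r mulNr.
rewrite mul1r orbF -{1}(prednK r_gt0) -natr1 addrAC [_ + 1]addrC addrK.
by case: (E); rewrite ?subr0 ?subrr.
Qed.

Lemma pairing_hiddenE (X : input R N T) (s : nat) (le_sT : (s <= T)%N)
    (j : 'I_(rnn_rank W s)) :
  (forall t, X t = x (y t)) ->
  rnn_hidden f X le_sT j =
    if s == T then (~~ mismatched y s./2)%:R
    else (mismatched y s./2 || odd s && (y s.-1 != j :> nat))%:R.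
Proof.
move=> X_E; elim: s le_sT j => [|s IHs] lt_sT j.
  (* With no pair read the flag is 0, which is the initial state; [T_gt0] rules out the complemented
     branch. *)
  by rewrite (ltn_eqF T_gt0).
rewrite [LHS]/= -(pairing_stepE lt_sT (ltn_ord j)).
by under eq_bigr => i _ do under eq_bigr => k _ do
  rewrite X_E mismatch_mxE IHs (ltn_eqF lt_sT) xi_bool.
Qed.

End Grid.
End PairingNetwork.

(** * Matricization by position parity, and the rank of one shallow term *)

Section PairTuple.
Variables (M r h : nat).
Hypothesis le_rM : (r <= M)%N.
Let K := {ffun 'I_h.+1 -> 'I_r}.

(** Here [a] indexes a row and [b] a column of the matricization. The position [t] is a natural
    number because [mismatched] takes sequences on [nat]. *)
Definition pair_index (a b : K) (t : nat) : 'I_M :=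
  widen_ord le_rM ((if odd t then b else a) (inord t./2)).

Definition pair_tuple (a b : K) : (h.+1.*2).-tuple 'I_M :=
  [tuple pair_index a b t | t < h.+1.*2].

Lemma mismatched_pair_index (a b : K) :
  mismatched (fun t => pair_index a b t) h.+1 = (a != b).
Proof.
apply/idP/idP => [/hasP[k _ neq_ab]|/eqP neq_ab]; last apply/hasP.
  apply/eqP => eq_ab.
  case/eqP: neq_ab; rewrite eq_ab /pair_index /= uphalf_double doubleK.
  by rewrite !if_same.
have [i nab|all_ab] := pickP (fun i => a i != b i); last first.
  by case: neq_ab; apply/ffunP => i; apply/eqP; exact: negbFE (all_ab i).
exists (i : nat); first by rewrite mem_iota /= add0n ltn_ord.
rewrite /pair_index /= odd_double uphalf_double doubleK inord_val.
by rewrite (inj_eq val_inj).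
Qed.

Lemma xin_pair_rank (R : realType) (c : 'I_h.+1.*2 -> 'I_M -> R)
    (lambda : R) :
  (\rank (\matrix_(i < #|K|, j < #|K|)
     (lambda * xin (fun t =>
        c t (tnth (pair_tuple (enum_val i) (enum_val j)) t))))%R
   <= h.+1 * M)%N.
Proof.
have lt_dbl (s : 'I_h.+1) : (s.*2 < h.+1.*2)%N by rewrite ltn_double.
pose u (a : K) (s : 'I_h.+1) := c (Ordinal (lt_dbl s)) (widen_ord le_rM (a s)).
pose top (a : K) := [arg max_(s > ord0) u a s]%O.
(* The maximizing pair together with the template index used there determines row [a]; this takes at
   most [h.+1 * M] values. *)
pose q (a : K) := (top a, widen_ord le_rM (a (top a))).
(* The trailing operand 0 of [xin] is absorbed here, so the row part is a plain maximum over a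
   nonempty set and is attained. *)
pose w (b : K) := \big[Num.max/0]_(t < h.+1.*2 | odd t)
  c t (widen_ord le_rM (b (inord t./2))).
pose D (k : 'I_h.+1 * 'I_M) (j : 'I_#|K|) :=
  lambda * Num.max (c (Ordinal (lt_dbl k.1)) k.2) (w (enum_val j)).
have xinE a b : xin (fun t => c t (tnth (pair_tuple a b) t))
    = Num.max (u a (top a)) (w b).
  rewrite /xin; apply/le_anti/andP; split.
    apply: bigmax_le => [|t _]; first by rewrite le_max bigmax_ge_id orbT.
    rewrite tnth_mktuple /pair_index le_max; case odd_t: (odd t).
      apply/orP; right.
      exact: (le_bigmax_cond _ (fun t =>
        c t (widen_ord le_rM (b (inord t./2))))).
    apply/orP; left; rewrite /top; case: arg_maxP => //= s _ max_s.
    apply: le_trans (max_s (inord t./2) isT).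
    rewrite /u; have -> // : Ordinal (lt_dbl (inord t./2)) = t.
    apply: val_inj; rewrite /= inordK; last by rewrite ltn_half_double.
    by rewrite -[RHS]odd_double_half odd_t.
  rewrite ge_max; apply/andP; split.
    apply: le_trans (le_bigmax _ _ (Ordinal (lt_dbl (top a)))).
    by rewrite tnth_mktuple /pair_index /= odd_double doubleK inord_val.
  apply: bigmax_le => [|t odd_t]; first exact: bigmax_ge_id.
  apply: le_trans (le_bigmax _ _ t).
  by rewrite tnth_mktuple /pair_index odd_t.
have -> : (h.+1 * M = #|{: 'I_h.+1 * 'I_M}|)%N by rewrite card_prod !card_ord.
suff -> : \matrix_(i, j) (lambda * xin (fun t =>
      c t (tnth (pair_tuple (enum_val i) (enum_val j)) t)))
    = \matrix_(i, j) D (q (enum_val i)) j :> 'M_#|K|.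
  exact: (mxrank_factor_leq (fun i : 'I_#|K| => q (enum_val i))).
by apply/matrixP=> i j; rewrite !mxE xinE.
Qed.

End PairTuple.

Theorem theorem5p2 (R : realType) (N M T : nat)
    (N_gt0 : (0 < N)%N) (M_gt0 : (0 < M)%N) (T_gt0 : (0 < T)%N)
    (T_even : ~~ odd T)
    (f : 'cV[R]_N -> 'cV[R]_M) (x : 'I_M -> 'cV[R]_N)
    (F_inv : feature_matrix f x \in unitmx)
    (rmax : nat) (rmax_gt0 : (0 < rmax)%N) :
  exists W : rnn R M T,
    (forall t : nat, (0 < t < T)%N -> (rnn_rank W t <= rmax)%N) /\
    (forall S : shallow_net R M T,
       grid_tensor x (shallow_score f S) = grid_tensor x (rnn_score f W) ->
       2%:R / (M%:R * T%:R) * (minn M rmax)%:R ^+ T./2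
         <= (sn_width S)%:R :> R).
Proof.
set r := minn M rmax.
have r_gt0 : (0 < r)%N by rewrite leq_min M_gt0.
have le_rM : (r <= M)%N := geq_minl M rmax.
(* Writing the number of pairs as a successor makes the type of pair positions inhabited, as [inord]
   requires. *)
have [h ET] : exists h, T = h.+1.*2.
  exists (T./2.-1); rewrite prednK ?even_halfK //.
  by rewrite half_gt0; case: T T_gt0 T_even => [|[]].
subst T; exists (pairing_rnn r_gt0 T_even (feature_matrix f x)); split.
  move=> t _; rewrite /= /pairing_rank; case: ifP => // _.
  exact: geq_minr.
move=> S eq_grid; rewrite doubleK.
pose K := {ffun 'I_h.+1 -> 'I_r}.
(* As [#|K|] is [r ^ h.+1] and [h.+1 * M] is [M T / 2], this is the claimed bound with denominators
   cleared. *)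
suff le_rank : (#|K| <= sn_width S * (h.+1 * M))%N.
  move: le_rank; rewrite card_ffun !card_ord; move: (sn_width S) => w le_w.
  rewrite mulrAC ler_pdivrMr ?mulr_gt0 ?ltr0n //.
  rewrite -natrX -!natrM ler_nat -muln2 !mulnA [(2 * _)%N]mulnC leq_mul2r.
  by rewrite -mulnA [(M * _)%N]mulnC.
pose p (i j : 'I_#|K|) := pair_tuple le_rM (enum_val i) (enum_val j).
pose A := \matrix_(i, j) grid_tensor x (shallow_score f S) (p i j).
(* Read through the recurrent network, [A] is the identity matrix: the score is 1 exactly when the
   row and column indices coincide. *)
have <- : (\rank A = #|K|)%N.
  rewrite -[RHS](@mxrank1 R); congr (\rank _).
  rewrite /A eq_grid; apply/matrixP=> i j; rewrite !mxE ffunE /rnn_score.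
  rewrite (pairing_hiddenE T_gt0 F_inv
    (y := pair_index le_rM (enum_val i) (enum_val j))) => [|t|t].
  - rewrite eqxx doubleK mismatched_pair_index negbK.
    by rewrite (inj_eq enum_val_inj).
  - by rewrite /pair_index /=; case: ifP => _; exact: ltn_ord.
  - by rewrite tnth_mktuple.
(* Read through the shallow network, the same [A] is a sum of one low-rank matrix per hidden
   unit. *)
have -> : A = \sum_r0 \matrix_(i, j) (sn_lambda r0 * xin (fun t =>
      dotv (f (x (tnth (p i j) t))) (sn_v (s := S) r0 t))).
  apply/matrixP => i j; rewrite summxE !mxE ffunE.
  by apply: eq_bigr => k _; rewrite mxE.
apply: mxrank_sum_leq => k.
exact: (xin_pair_rank le_rM (fun t m => dotv (f (x m)) (sn_v (s := S) k t))).
Qed.
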